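(* The four graph parameters $\delta_\chi$, $\delta_{\mathrm{hom}}$, $\delta_{\mathrm{VC}}$ and $\delta_{\mathrm B}$ are pairwise distinct; that is, for any two different parameters $\delta_*,\delta_{**}$ among these four, there exists a graph $H$ with $\delta_*(H)\ne\delta_{**}(H)$.
   Context: All graphs are finite and simple. A graph is $H$-free if it contains no (not necessarily induced) subgraph isomorphic to $H$; it is maximal $H$-free if it is $H$-free and adding any missing edge creates a copy of $H$. $\delta(G)$ denotes minimum degree. The chromatic threshold $\delta_\chi(H)$ is the infimum of all $\gamma>0$ for which there is a constant $C=C(\gamma,H)$ such that every $H$-free graph $G$ with $\delta(G)\ge\gamma|V(G)|$ has $\chi(G)\le C$. The homomorphism threshold $\delta_{\mathrm{hom}}(H)$ is the infimum of all $\gamma\ge 0$ for which there exists a (finite) $H$-free graph $F=F(\gamma,H)$ such that every $H$-free graph $G$ with $\delta(G)\ge\gamma|V(G)|$ admits a graph homomorphism to $F$. The VC-dimension $\mathrm{VC}(G)$ of a graph $G$ is the maximum size of a set $S\subseteq V(G)$ such that $\{N_G(v)\cap S: v\in V(G)\}=2^S$. The VC-dimension threshold $\delta_{\mathrm{VC}}(H)$ is the infimum of all $\gamma\ge 0$ for which there exists a constant $C=C(\gamma,H)$ such that every maximal $H$-free graph $G$ with $\delta(G)\ge\gamma|V(G)|$ satisfies $\mathrm{VC}(G)\le C$. A blowup of a graph $F$ is obtained by replacing each vertex of $F$ by a (possibly empty) independent set and each edge of $F$ by a complete bipartite graph between the corresponding sets. The blowup threshold $\delta_{\mathrm B}(H)$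 is the infimum of all $\gamma\ge 0$ for which there exists a (finite) graph $F=F(\gamma,H)$ such that every maximal $H$-free graph $G$ with $\delta(G)\ge\gamma|V(G)|$ is a blowup of $F$. *)

(* Defs.v *)
From HB Require Import structures.
From mathcomp Require Import all_boot all_order all_algebra.
From mathcomp Require Import boolp classical_sets reals.
Set Implicit Arguments.
Unset Strict Implicit.
Unset Printing Implicit Defensive.
Import Order.TTheory GRing.Theory Num.Theory.

Record sgraph := SGraph {
  vertex :> finType;
  adj : rel vertex;
  adj_sym : symmetric adj;
  adj_irr : irreflexive adj }.

Definition nbh (G : sgraph) (v : G) : {set G} := [set w | adj v w].

(* The default value #|G| exceeds every degree, so this is the true minimum
   when G has a vertex; the graph without vertices gets minimum degree 0. *)
Definition min_degree (G : sgraph) : nat := \big[minn/#|G|]_(v : G) #|nbh v|.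

Definition is_hom (G F : sgraph) (f : G -> F) : Prop :=
  forall x y : G, adj x y -> adj (f x) (f y).

Definition homomorphic (G F : sgraph) : Prop := exists f : G -> F, is_hom f.

Definition isomorphic (G F : sgraph) : Prop :=
  exists2 f : G -> F, bijective f & forall x y : G, adj (f x) (f y) = adj x y.

(* G has a subgraph, not necessarily induced, isomorphic to H. *)
Definition contains_copy (H G : sgraph) : Prop :=
  exists2 f : H -> G, injective f & is_hom f.

Definition H_free (H G : sgraph) : Prop := ~ contains_copy H G.

Section AddEdge.
Variables (G : sgraph) (x y : G).

(* The edge xy is added only if x != y, so that no loop is created. *)
Definition add_adj : rel G := fun u v =>
  adj u v || (x != y) && ((u == x) && (v == y) || (u == y) && (v == x)).

Lemma add_adj_sym : symmetric add_adj.
Proof.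
move=> u v; rewrite /add_adj adj_sym; congr (_ || (_ && _)).
by rewrite orbC; congr (_ || _); rewrite andbC.
Qed.

Lemma add_adj_irr : irreflexive add_adj.
Proof.
move=> u; rewrite /add_adj adj_irr /=; apply/negP => /andP[nxy].
by case/orP => /andP[/eqP eu /eqP ev]; rewrite -eu -ev eqxx in nxy.
Qed.

Definition add_edge : sgraph := SGraph add_adj_sym add_adj_irr.
End AddEdge.

Definition maximal_free (H G : sgraph) : Prop :=
  H_free H G /\
  forall x y : G, x != y -> ~~ adj x y -> contains_copy H (add_edge x y).

Definition colorable (G : sgraph) (k : nat) : bool :=
  [exists c : {ffun G -> 'I_k},
     [forall x, forall y, adj x y ==> (c x != c y)]].

Lemma colorable_exists (G : sgraph) : exists k, colorable G k.
Proof.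
exists #|G|; apply/existsP; exists [ffun x => enum_rank x].
apply/forallP => x; apply/forallP => y; apply/implyP => xy.
rewrite !ffunE; apply/eqP => /enum_rank_inj exy.
by rewrite exy adj_irr in xy.
Qed.

Definition chromatic_number (G : sgraph) : nat := ex_minn (colorable_exists G).

Definition shattered (G : sgraph) (S : {set G}) : bool :=
  [set nbh v :&: S | v : G] == powerset S.

Definition vc_dim (G : sgraph) : nat := \max_(S : {set G} | shattered S) #|S|.

Section Blowup.
Variables (F : sgraph) (s : F -> nat).

(* Vertex i of F is replaced by the s i vertices (i, j) with j < s i. *)
Definition blowup_adj : rel {i : F & 'I_(s i)} :=
  fun u v => adj (tag u) (tag v).

Lemma blowup_adj_sym : symmetric blowup_adj.
Proof. by move=> u v; rewrite /blowup_adj adj_sym. Qed.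

Lemma blowup_adj_irr : irreflexive blowup_adj.
Proof. by move=> u; rewrite /blowup_adj adj_irr. Qed.

Definition blowup : sgraph := SGraph blowup_adj_sym blowup_adj_irr.
End Blowup.

Definition is_blowup (G F : sgraph) : Prop :=
  exists s : F -> nat, isomorphic G (blowup s).

Local Open Scope classical_set_scope.
Local Open Scope ring_scope.

(* The infima below are taken in R, where inf set0 = 0.  Each of the four sets
   contains every gamma >= 1, since then only the graph without vertices
   satisfies the degree condition; the sole exception is the set of delta_hom H
   for H without vertices, which is empty as no graph is H-free. *)
Section Thresholds.
Variable R : realType.

Definition dense_graph (gamma : R) (G : sgraph) : Prop :=
  gamma * #|G|%:R <= (min_degree G)%:R.

Definition delta_chi (H : sgraph) : R :=
  inf [set gamma : R | 0 < gamma /\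
    exists C : nat, forall G : sgraph,
      H_free H G -> dense_graph gamma G -> (chromatic_number G <= C)%N].

Definition delta_hom (H : sgraph) : R :=
  inf [set gamma : R | 0 <= gamma /\
    exists F : sgraph, H_free H F /\
      forall G : sgraph, H_free H G -> dense_graph gamma G -> homomorphic G F].

Definition delta_VC (H : sgraph) : R :=
  inf [set gamma : R | 0 <= gamma /\
    exists C : nat, forall G : sgraph,
      maximal_free H G -> dense_graph gamma G -> (vc_dim G <= C)%N].

Definition delta_B (H : sgraph) : R :=
  inf [set gamma : R | 0 <= gamma /\
    exists F : sgraph, forall G : sgraph,
      maximal_free H G -> dense_graph gamma G -> is_blowup G F].

End Thresholds.

Variant parameter := Chi | Hom | VC | Blow.

Definition delta (R : realType) (p : parameter) : sgraph -> R :=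
  match p with
  | Chi => @delta_chi R
  | Hom => @delta_hom R
  | VC => @delta_VC R
  | Blow => @delta_B R
  end.

(* Main.v *)
(** Three graphs separate the four thresholds.

    The disjoint union of a 4-cycle and a point.  Its dense free graphs have
    bounded order, so all thresholds except [delta_hom] vanish.  A free target
    of K4 has only four vertices, whereas Blanche Descartes' construction gives
    C4-free graphs that are not 4-colourable; hence [delta_hom] is positive.

    The 5-cycle.  A maximal family of vertices with disjoint neighbourhoods has
    bounded size and leads to a bounded colouring at every positive density.
    On the other hand a point-set incidence pattern can be frozen inside a
    maximal C5-free graph of linear minimum degree, by closing each non-incident
    pair with a private path of length four; hence [delta_VC >= 1/15].

    The wheel with four spokes.  Neighbourhoods are C4-free, and for minimum
    degree 49n/100 the vertices split into two sides each inducing a matching.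
    So the chromatic number is at most 4, and maximal free graphs are complete
    between the sides, with VC-dimension at most 4.  Perfect matchings on both
    sides of a balanced complete bipartite graph give twin-free maximal free
    graphs of minimum degree above n/2; hence [delta_B >= 1/2]. *)

Require Import Defs.
From HB Require Import structures.
From mathcomp Require Import all_boot all_order all_algebra.
From mathcomp Require Import boolp classical_sets reals.
From mathcomp Require Import fintype finset perm zify lra.
Set Implicit Arguments.
Unset Strict Implicit.
Unset Printing Implicit Defensive.
Import Order.TTheory GRing.Theory Num.Theory.

(** * Minimum degree, chromatic number and VC-dimension *)

Lemma min_degree_le (G : sgraph) (v : G) : min_degree G <= #|nbh v|.
Proof.
rewrite /min_degree; have: v \in index_enum G by rewrite mem_index_enum.
elim: (index_enum G) => // x r IH; rewrite in_cons big_cons => /orP[/eqP->|/IH].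
  exact: geq_minl.
by move=> h; rewrite geq_min h orbT.
Qed.

Lemma min_degree_le_card (G : sgraph) : min_degree G <= #|G|.
Proof.
rewrite /min_degree; elim/big_ind: _ => // [x y hx _|v _]; last exact: max_card.
by rewrite geq_min hx.
Qed.

Lemma le_min_degree (G : sgraph) (d : nat) :
  0 < #|G| -> (forall v : G, d <= #|nbh v|) -> d <= min_degree G.
Proof.
move=> /card_gt0P[v0 _] hd; rewrite /min_degree.
elim/big_ind: _ => // [|x y hx hy]; last by rewrite leq_min hx.
exact: leq_trans (hd v0) (max_card _).
Qed.

Lemma adj_neq (G : sgraph) (x y : G) : adj x y -> x != y.
Proof. by move=> h; apply/eqP => e; rewrite e adj_irr in h. Qed.

Lemma chromatic_number_le (G : sgraph) (T : finType) (c : G -> T) (k : nat) :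
  #|T| <= k -> (forall x y, adj x y -> c x != c y) -> chromatic_number G <= k.
Proof.
move=> hk hc; rewrite /chromatic_number; case: ex_minnP => m _; apply.
apply/existsP; exists [ffun x => widen_ord hk (enum_rank (c x))].
apply/forallP => x; apply/forallP => y; apply/implyP => /hc; rewrite !ffunE.
apply: contra => /eqP /(congr1 val) /= e.
by apply/eqP/enum_rank_inj/val_inj.
Qed.

Lemma vc_dim_le_card (G : sgraph) : vc_dim G <= #|G|.
Proof. by apply/bigmax_leqP => S _; apply: max_card. Qed.

(** * Blowups and maximal free graphs *)

Lemma is_blowup_of_embedding (G F : sgraph) (g : G -> F) :
  injective g -> (forall x y, adj (g x) (g y) = adj x y) -> is_blowup G F.
Proof.
(* Vertices of [F] outside the image are replaced by empty sets, all others by one vertex. *)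
move=> ginj gadj; pose s (i : F) : nat := i \in codom g.
have sg x : 0 < s (g x) by rewrite /s codom_f.
exists s; exists (fun x => Tagged (fun i => 'I_(s i)) (Ordinal (sg x))) => //.
apply: (inj_card_bij (f := fun x => Tagged (fun i => 'I_(s i)) (Ordinal (sg x)))).
  by move=> x y /(congr1 tag) /ginj.
rewrite -[X in _ <= X]/(#|G|) -(card_codom ginj).
apply: leq_trans (_ : #|[set tag u | u : {i : F & 'I_(s i)}]| <= _).
  rewrite card_imset // => -[i j] [i' j'] /= ei; case: _ / ei j' => j'.
  congr Tagged; apply/val_inj; case: j j' => [j hj] [j' hj'] /=.
  by move: (hj) (hj'); rewrite {1 2}/s; case: (i \in _) => //; case: j {hj}; case: j' {hj'}.
apply/subset_leq_card/subsetP => i /imsetP[[i' [j hj]] _ ->] /=.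
by move: (hj); rewrite {1}/s; case: (i' \in _).
Qed.

Definition twin_free (G : sgraph) : Prop := injective (@nbh G).

(** Vertices replacing the same vertex of [F] are twins, so each class has at most one element. *)
Lemma blowup_twin_free_card (G F : sgraph) :
  twin_free G -> is_blowup G F -> #|G| <= #|F|.
Proof.
move=> tf [s [f fbij fadj]]; apply: (leq_card (fun x => tag (f x))) => x y e.
apply: tf; apply/setP => z; rewrite !inE -!fadj.
by rewrite /= /blowup_adj e.
Qed.

(** The first coordinate codes a graph by an arbitrary set of ordered pairs; only off-diagonal pairs
    present in both orders count as edges. *)
Definition universal_adj (N : nat) : rel ({set 'I_N * 'I_N} * 'I_N) :=
  fun u v => [&& u.1 == v.1, u.2 != v.2, (u.2, v.2) \in u.1 & (v.2, u.2) \in u.1].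

Lemma universal_adj_sym (N : nat) : symmetric (@universal_adj N).
Proof.
move=> [E i] [E' j]; rewrite /universal_adj /= eq_sym (eq_sym i).
by case: eqP => //= ->; rewrite (andbC (_ \in _)).
Qed.

Lemma universal_adj_irr (N : nat) : irreflexive (@universal_adj N).
Proof. by move=> [E i]; rewrite /universal_adj /= !eqxx. Qed.

(* The disjoint union of all labelled graphs on N vertices. *)
Definition universal_graph (N : nat) : sgraph :=
  SGraph (@universal_adj_sym N) (@universal_adj_irr N).

Lemma is_blowup_universal (N : nat) (G : sgraph) :
  #|G| <= N -> is_blowup G (universal_graph N).
Proof.
move=> hN; pose g (x : G) := widen_ord hN (enum_rank x).
have ginj : injective g by move=> x y /(congr1 val) /= /val_inj /enum_rank_inj.
pose E := [set e | [exists x, exists y, adj x y && (e == (g x, g y))]].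
have memE x y : ((g x, g y) \in E) = adj x y.
  rewrite inE; apply/existsP/idP => [[x' /existsP[y']]|h].
    by rewrite xpair_eqE !(inj_eq ginj) => /andP[h /andP[/eqP-> /eqP->]].
  by exists x; apply/existsP; exists y; rewrite h eqxx.
apply: (@is_blowup_of_embedding _ _ (fun x => (E, g x) : universal_graph N)).
  by move=> x y /(congr1 snd) /ginj.
move=> x y; rewrite /= /universal_adj /= eqxx !memE (adj_sym y x) andbb /=.
by case h: (adj x y); rewrite ?andbF // andbT (inj_eq ginj) adj_neq.
Qed.

(** Edges are added as long as the graph stays free; the number of non-adjacent pairs drops each
    time. *)
Lemma maximal_free_extension (H G : sgraph) : H_free H G ->
  exists (G' : sgraph) (f : G -> G'),
    [/\ bijective f, is_hom f & maximal_free H G'].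
Proof.
have [k] := ubnP #|[set e : G * G | ~~ adj e.1 e.2]|.
elim: k G => // k IH G /ltnSE hk hG.
case: (pselect (maximal_free H G)) => [hm|nm].
  by exists G, id; split => //; exists id.
have [x [y [nxy axy fr]]] : exists x y : G,
    [/\ x != y, ~~ adj x y & H_free H (add_edge x y)].
  apply: contrapT => h; apply: nm; split => // x y nxy axy.
  by apply: contrapT => fr; apply: h; exists x, y.
have [||G' [f [fb fh fm]]] := IH (add_edge x y) => //.
  apply: leq_trans hk; apply: proper_card; apply/properP; split.
    by apply/subsetP => -[a b]; rewrite !inE /= /add_adj negb_or => /andP[].
  by exists (x, y); rewrite !inE //= /add_adj nxy !eqxx orbT.
exists G', f; split => // a b ab; apply: fh.
by rewrite /= /add_adj ab.
Qed.

Lemma hom_min_degree (G G' : sgraph) (f : G -> G') : 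
  bijective f -> is_hom f -> min_degree G <= min_degree G'.
Proof.
move=> fb fh; have [g fK gK] := fb; have e := bij_eq_card fb.
have [h|h] := posnP #|G|.
  by apply: leq_trans (min_degree_le_card G) _; rewrite h.
apply: le_min_degree; first by rewrite -e.
move=> v; apply: leq_trans (min_degree_le (g v)) _.
rewrite -(card_imset _ (bij_inj fb)); apply/subset_leq_card/subsetP => _ /imsetP[w + ->].
by rewrite !inE => /fh; rewrite gK.
Qed.

(** * Counting almost disjoint sets *)

Lemma card_almost_disjoint (I T : finType) (D : {set I}) (A : I -> {set T}) (c d : nat) :
  (forall i, i \in D -> d <= #|A i|) ->
  (forall i j, i \in D -> j \in D -> i != j -> #|A i :&: A j| <= c) ->
  #|D| * d <= #|T| + c * #|D| ^ 2.
Proof.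
move=> hd hc.
(* The sets are added one at a time; each meets the union of those already present in at most
   [c * size s] points. *)
suff: forall s : seq I, uniq s -> {subset s <= D} ->
    size s * d <= #|\bigcup_(i <- s) A i| + c * size s ^ 2.
  move=> /(_ (enum D) (enum_uniq _)) h; rewrite cardE.
  apply: leq_trans (h _) _; first by move=> x; rewrite mem_enum.
  by rewrite leq_add2r max_card.
elim=> [|i s IH] //=; rewrite big_cons => /andP[his us] sD.
have iD : i \in D by apply: sD; rewrite mem_head.
have {IH} := IH us (fun x h => sD x (@mem_behead _ (_ :: s) x h)).
have := cardsUI (A i) (\bigcup_(i <- s) A i).
have := hd _ iD.
suff: #|A i :&: \bigcup_(j <- s) A j| <= c * size s by nia.
have: {subset s <= D} by move=> x h; apply: sD; rewrite in_cons h orbT.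
elim: s his {us sD} => [|j s IH]; first by rewrite big_nil setI0 cards0.
rewrite in_cons negb_or => /andP[nij his] sD.
have h1 := IH his (fun x h => sD x (@mem_behead _ (_ :: s) x h)).
have h2 := hc _ _ iD (sD j (mem_head _ _)) nij.
rewrite big_cons setIUr /= mulnS.
exact: leq_trans (leq_card_setU _ _) (leq_add h2 h1).
Qed.

Lemma subset_of_card (T : finType) (D : {set T}) (k : nat) :
  k <= #|D| -> exists2 E : {set T}, E \subset D & #|E| = k.
Proof.
move=> hk; exists [set x in take k (enum D)].
  by apply/subsetP => x; rewrite inE => /mem_take; rewrite mem_enum.
by rewrite cardsE (card_uniqP _) ?take_uniq ?enum_uniq // size_takel // -cardE.
Qed.

(** * Graphs given by edge lists *)

Lemma edge_adj_sym n (es : seq (nat * nat)) : symmetric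
  (fun i j : 'I_n => (i != j) && (((i : nat, j : nat) \in es) || ((j : nat, i : nat) \in es))).
Proof. by move=> i j; rewrite eq_sym orbC. Qed.

Lemma edge_adj_irr n (es : seq (nat * nat)) : irreflexive
  (fun i j : 'I_n => (i != j) && (((i : nat, j : nat) \in es) || ((j : nat, i : nat) \in es))).
Proof. by move=> i; rewrite eqxx. Qed.

Definition edge_graph (n : nat) (es : seq (nat * nat)) : sgraph :=
  SGraph (@edge_adj_sym n es) (@edge_adj_irr n es).

Lemma edge_graph_copy (n : nat) (es : seq (nat * nat)) (G : sgraph) (x0 : G) (s : seq G) :
  size s = n -> uniq s -> all (fun e => adj (nth x0 s e.1) (nth x0 s e.2)) es ->
  contains_copy (edge_graph n es) G.
Proof.
move=> sz us /allP hs; exists (fun i : 'I_n => nth x0 s i).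
  move=> i j /eqP; rewrite nth_uniq ?sz //.
  by move=> /eqP /val_inj.
move=> i j /= /andP[_ /orP[|] /hs //=].
by rewrite adj_sym.
Qed.

(** * The wheel with four spokes: structure of dense free graphs *)

Definition wheel4 : sgraph := edge_graph 5
  [:: (0, 1); (0, 2); (0, 3); (0, 4); (1, 2); (2, 3); (3, 4); (4, 1)].

(** Two such common neighbours y, y' would give the rim x y x' y' around the hub [h]. *)
Lemma wheel4_free_codegree (G : sgraph) (h x x' : G) :
  H_free wheel4 G -> x != x' -> adj h x -> adj h x' ->
  #|nbh h :&: nbh x :&: nbh x'| <= 1.
Proof.
move=> fr nx hx hx'; rewrite leqNgt; apply/negP => /card_gt1P[y [y' []]].
rewrite !inE -!andbA => /and3P[hy xy x'y] /and3P[hy' xy' x'y'] ny.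
apply: fr; apply: (@edge_graph_copy _ _ _ h [:: h; x; y; x'; y']) => //=.
  rewrite !inE !negb_or (adj_neq hx) (adj_neq hx') (adj_neq hy) (adj_neq hy').
  by rewrite nx ny (adj_neq xy) (adj_neq xy') (adj_neq x'y') eq_sym (adj_neq x'y).
by rewrite hx hy hx' hy' xy x'y' ![adj _ x']adj_sym ![adj _ x]adj_sym x'y xy'.
Qed.

Definition bimatching (G : sgraph) (side : G -> bool) : Prop :=
  forall x y z, adj x y -> adj x z -> side y = side x -> side z = side x -> y = z.

(** At most one rim vertex can share the side of the hub. Three consecutive rim vertices then lie on
    the other side, and the middle one has two neighbours there. *)
Lemma bimatching_wheel4_free (G : sgraph) (side : G -> bool) :
  bimatching side -> H_free wheel4 G.
Proof.
move=> bm [f finj fh].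
pose o0 := @Ordinal 5 0 isT; pose o1 := @Ordinal 5 1 isT.
pose o2 := @Ordinal 5 2 isT; pose o3 := @Ordinal 5 3 isT; pose o4 := @Ordinal 5 4 isT.
have key a b c : adj (a : wheel4) b -> adj (a : wheel4) c -> b != c ->
    side (f b) = side (f a) -> side (f c) = side (f a) -> False.
  move=> ab ac nbc sb sc; case/eqP: nbc; apply: finj.
  exact: bm (fh _ _ ab) (fh _ _ ac) sb sc.
have k012 := key o0 o1 o2 isT isT isT; have k013 := key o0 o1 o3 isT isT isT.
have k014 := key o0 o1 o4 isT isT isT; have k023 := key o0 o2 o3 isT isT isT.
have k024 := key o0 o2 o4 isT isT isT; have k034 := key o0 o3 o4 isT isT isT.
have k124 := key o1 o2 o4 isT isT isT; have k213 := key o2 o1 o3 isT isT isT.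
have k324 := key o3 o2 o4 isT isT isT; have k413 := key o4 o1 o3 isT isT isT.
move: k012 k013 k014 k023 k024 k034 k124 k213 k324 k413.
by case: (side (f o0)); case: (side (f o1)); case: (side (f o2));
  case: (side (f o3)); case: (side (f o4)); tauto.
Qed.

(** The colour is the side together with whether the partner on that side comes earlier in the
    enumeration. *)
Lemma bimatching_chromatic (G : sgraph) (side : G -> bool) :
  bimatching side -> chromatic_number G <= 4.
Proof.
move=> bm; pose c x := (side x,
  [exists y, [&& adj x y, side y == side x & enum_rank y < enum_rank x]]).
apply: (chromatic_number_le (c := c)); first by rewrite card_prod card_bool.
have nosame x y : adj x y -> side x = side y -> enum_rank x < enum_rank y ->
    [exists z, [&& adj x z, side z == side x & enum_rank z < enum_rank x]] = false.
  move=> xy s lt; apply/existsP => -[z /and3P[xz /eqP sz lz]].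
  have e := bm _ _ _ xy xz (esym s) sz; rewrite e in lt.
  by move: (ltn_trans lt lz); rewrite ltnn.
have below x y : adj x y -> side x = side y -> enum_rank x < enum_rank y ->
    [exists z, [&& adj y z, side z == side y & enum_rank z < enum_rank y]].
  by move=> xy s lt; apply/existsP; exists x; rewrite adj_sym xy s eqxx.
move=> x y xy; apply/eqP => -[s e].
have: enum_rank x != enum_rank y by rewrite (inj_eq enum_rank_inj) adj_neq.
rewrite neq_ltn => /orP[] lt.
  by move: e; rewrite (nosame x y) // (below x y).
have yx : adj y x by rewrite adj_sym.
by move: e; rewrite (below y x) // (nosame y x).
Qed.

(** A new edge between the sides keeps the bimatching, hence creates no wheel. *)
Lemma maximal_bimatching_complete (G : sgraph) (side : G -> bool) (x y : G) :
  bimatching side -> maximal_free wheel4 G -> side x != side y -> adj x y.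
Proof.
move=> bm [_ mx] nxy; apply: contraT => nadj; case: notF.
have nx : x != y by apply: contra nxy => /eqP->.
suff fr : H_free wheel4 (add_edge x y) by case: (fr (mx _ _ nx nadj)).
apply: (@bimatching_wheel4_free (add_edge x y) side) => a b c.
have old u v : adj (u : add_edge x y) v -> side v = side u -> @adj G u v.
  rewrite /= /add_adj => /orP[//|/andP[_]].
  by case/orP => /andP[/eqP-> /eqP->] s; move: nxy; rewrite s eqxx.
by move=> ab ac sb sc; apply: bm (old _ _ ab sb) (old _ _ ac sc) sb sc.
Qed.

(** A shattered set has at most two points on each side: a vertex tracing exactly two of three such
    points would have two neighbours on its own side, or be adjacent to all three from the other. *)
Lemma maximal_bimatching_vc_dim (G : sgraph) (side : G -> bool) :
  bimatching side -> maximal_free wheel4 G -> vc_dim G <= 4.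
Proof.
move=> bm mx; apply/bigmax_leqP => S /eqP sh.
suff half b : #|S :&: [set x | side x == b]| <= 2.
  rewrite -(cardsID [set x | side x == true] S).
  apply: (@leq_add _ _ 2 2) => //; apply: leq_trans (half false).
  by apply/subset_leq_card/subsetP => x; rewrite !inE; case: (side x); case: (x \in S).
rewrite leqNgt; apply/negP => /card_gt2P[x [y [z []]]].
case; rewrite !inE => /andP[xS /eqP sx] /andP[yS /eqP sy] /andP[zS /eqP sz].
case=> nxy nyz nzx.
have: [set x; y] \in powerset S.
  by rewrite inE; apply/subsetP => u; rewrite !inE => /orP[] /eqP->.
rewrite -sh => /imsetP[v _ e].
have vx : adj v x by have := set21 x y; rewrite e !inE => /andP[].
have vy : adj v y by have := set22 x y; rewrite e !inE => /andP[].
have vz : ~~ adj v z.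
  apply/negP => vz; have: z \in nbh v :&: S by rewrite !inE vz zS.
  by rewrite -e !inE (negbTE nzx) eq_sym (negbTE nyz).
have [s|s] := eqVneq (side v) b.
  by move: nxy; rewrite (bm _ _ _ vx vy) ?eqxx // ?sx ?sy s.
by move: vz; rewrite (maximal_bimatching_complete bm mx) // sz.
Qed.

(** The sets N(x) ∩ N(v) for x in N(v) pairwise share at most one vertex. If 200 of them had size at
    least n/100, packing would give 2n <= n + 200^2. *)
Lemma few_large_codegrees (G : sgraph) (v : G) :
  200 * 200 < #|G| -> H_free wheel4 G ->
  #|[set x in nbh v | #|G| <= 100 * #|nbh x :&: nbh v|]| < 200.
Proof.
move=> hn fr; rewrite ltnNge; apply/negP => /subset_of_card[E sE cE].
have := @card_almost_disjoint G G E (fun x => nbh x :&: nbh v) 1 ((#|G| + 99) %/ 100).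
rewrite cE => h; have {h} : 200 * ((#|G| + 99) %/ 100) <= #|G| + 1 * 200 ^ 2.
  apply: h => [x /(subsetP sE)|x y /(subsetP sE) + /(subsetP sE)].
    rewrite inE => /andP[_]; lia.
  rewrite !inE => /andP[vx _] /andP[vy _] nxy.
  have := wheel4_free_codegree fr nxy vx vy.
  have -> // : nbh x :&: nbh v :&: (nbh y :&: nbh v) = nbh v :&: nbh x :&: nbh y.
  apply/setP => z; rewrite !inE.
  by case: (adj v z); rewrite ?andbF ?andbT.
rewrite -mulnn; move: hn; lia.
Qed.

Lemma card_setI3 (T : finType) (A B C Y : {set T}) :
  #|A :&: Y| + #|B :&: Y| + #|C :&: Y| <= #|A :&: B :&: C| + 2 * #|Y|.
Proof.
have h1 := cardsUI (A :&: Y) (B :&: Y).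
have h2 := cardsUI (A :&: B :&: Y) (C :&: Y).
have : (A :&: Y) :&: (B :&: Y) = A :&: B :&: Y by rewrite setIACA setIid.
have : (A :&: B :&: Y) :&: (C :&: Y) = A :&: B :&: C :&: Y by rewrite setIACA setIid.
have : #|A :&: Y :|: B :&: Y| <= #|Y|.
  by apply: subset_leq_card; rewrite -setIUl subsetIr.
have : #|A :&: B :&: Y :|: C :&: Y| <= #|Y|.
  by apply: subset_leq_card; rewrite -setIUl subsetIr.
have : #|A :&: B :&: C :&: Y| <= #|A :&: B :&: C|.
  by apply: subset_leq_card; rewrite subsetIl.
move=> h3 h4 h5 e1 e2; rewrite e1 e2 in h1 h2; lia.
Qed.

Lemma card_setI_missing (T : finType) (U A B Y : {set T}) :
  #|U :&: Y| <= #|U :&: A :&: B| + #|Y :\: A| + #|Y :\: B|.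
Proof.
apply: leq_trans (_ : #|(U :&: A :&: B) :|: (Y :\: A) :|: (Y :\: B)| <= _).
  apply/subset_leq_card/subsetP => z; rewrite !inE => /andP[-> ->].
  by case: (z \in A); case: (z \in B).
apply: leq_trans (leq_card_setU _ _) _.
by rewrite leq_add2r leq_card_setU.
Qed.

(** Two disjoint sets [X] and [Y] of almost n/2 vertices are found such that every neighbourhood
    lies mostly in one of them, which determines the side. A vertex and two neighbours on its side
    would then have more than one common neighbour. *)
Lemma wheel4_free_bimatching (G : sgraph) :
  200 * 200 < #|G| -> (forall v : G, 49 * #|G| <= 100 * #|nbh v|) ->
  H_free wheel4 G -> exists side : G -> bool, bimatching side.
Proof.
move=> hn hd fr; set n := #|G| in hn hd *.
have /card_gt0P[v _] : 0 < #|G| by apply: leq_trans hn.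
pose X := nbh v; pose D := [set x in X | n <= 100 * #|nbh x :&: X|].
have hD : #|D| < 200 by apply: few_large_codegrees.
have hX := hd v; rewrite -/X in hX.
have [w] : exists w, w \in X :\: D.
  apply/card_gt0P; have := cardsID D X; have := subset_leq_card (subsetIr X D); lia.
rewrite 3!inE negb_and => /andP[/orP[/negP//|]]; rewrite -ltnNge => hw wX.
(* As [w] is outside [D], it has fewer than n/100 neighbours in [X]; this leaves 48n/100 for [Y]. *)
pose Y := nbh w :\: X.
have hY : 48 * n <= 100 * #|Y|.
  by have := cardsID X (nbh w); have := hd w; rewrite -/Y; lia.
have cXY : #|X :|: Y| = #|X| + #|Y|.
  have := cardsUI X Y; have -> : X :&: Y = set0.
    by apply/setP => z; rewrite !inE; case: (adj v z).
  by rewrite cards0 addn0.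
have XY : #|X| + #|Y| <= n by rewrite -cXY max_card.
have split3 u : 49 * n <= 100 * (#|nbh u :&: X| + #|nbh u :&: Y| + (n - #|X| - #|Y|)).
  have := hd u; have := cardsID X (nbh u); have := cardsID Y (nbh u :\: X).
  have -> : (nbh u :\: X) :&: Y = nbh u :&: Y.
    by apply/setP => z; rewrite !inE; case: (adj v z); rewrite ?andbF.
  have : #|nbh u :\: X :\: Y| <= n - #|X| - #|Y|.
    rewrite /n -(cardsC (X :|: Y)) cXY.
    have : #|nbh u :\: X :\: Y| <= #|~: (X :|: Y)|.
      by apply/subset_leq_card/subsetP => z; rewrite !inE negb_or => /and3P[-> ->].
    by lia.
  lia.
(* Such an [x] has at least 48n/100 neighbours outside [X], where there are at most 51n/100
   vertices. *)
have typical x : x \in X -> x \notin D -> 100 * #|Y :\: nbh x| <= 3 * n.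
  move=> xX; rewrite inE xX /= -ltnNge => hx.
  have := cardsID X (nbh x); have := hd x.
  have : #|Y :\: nbh x| + #|nbh x :\: X| + #|X| <= n.
    rewrite /n -(cardsC X) [#|X| + _]addnC leq_add2r.
    have := cardsUI (Y :\: nbh x) (nbh x :\: X).
    have -> : (Y :\: nbh x) :&: (nbh x :\: X) = set0.
      by apply/setP => z; rewrite !inE; case: (adj x z); rewrite ?andbF.
    rewrite cards0 addn0 => <-; apply/subset_leq_card/subsetP => z.
    by rewrite !inE; case: (adj v z); rewrite ?andbF.
  lia.
(* As [D] has fewer than 200 elements, [u] has two typical neighbours in [X]. Each misses at most
   3n/100 of [Y], and the two share at most one neighbour with [u]; 7n/100 absorbs that vertex. *)
have dich u : 201 < #|nbh u :&: X| -> 100 * #|nbh u :&: Y| <= 7 * n.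
  move=> hu; have : 1 < #|(nbh u :&: X) :\: D|.
    have := cardsID D (nbh u :&: X).
    by have := subset_leq_card (subsetIr (nbh u :&: X) D); lia.
  case/card_gt1P => x [y []]; rewrite in_setD => /andP[xD +].
  rewrite in_setI => /andP[ux xX]; rewrite in_setD => /andP[yD].
  rewrite in_setI => /andP[uy yX] nxy.
  have hx := typical _ xX xD; have hy := typical _ yX yD.
  rewrite !inE in ux uy; have h := wheel4_free_codegree fr nxy ux uy.
  have : #|nbh u :&: Y| <= #|nbh u :&: nbh x :&: nbh y| + #|Y :\: nbh x| + #|Y :\: nbh y|.
    exact: card_setI_missing.
  lia.
exists (fun u => 201 < #|nbh u :&: X|) => a b c ab ac sb sc.
apply/eqP; apply: contraT => nbc.
have := wheel4_free_codegree fr nbc ab ac.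
have := card_setI3 (nbh a) (nbh b) (nbh c) X.
have := card_setI3 (nbh a) (nbh b) (nbh c) Y.
have := split3 a; have := split3 b; have := split3 c.
have := dich a; have := dich b; have := dich c.
case: (ltnP 201 #|nbh a :&: X|) sb sc => ha sb sc.
  by rewrite sb sc => /(_ isT) h1 /(_ isT) h2 /(_ isT) h3; lia.
move=> _ _ _; lia.
Qed.

(** * Complete bipartite graphs with a perfect matching on each side *)

Definition doubled_matching_adj (M : nat) : rel (bool * 'I_M * bool) :=
  fun u v => (u.1.1 != v.1.1) || (u.1.2 == v.1.2) && (u.2 != v.2).

Lemma doubled_matching_adj_sym (M : nat) : symmetric (@doubled_matching_adj M).
Proof.
move=> u v; rewrite /doubled_matching_adj.
by rewrite ![_ == v.1.1]eq_sym ![_ == v.1.2]eq_sym ![_ == v.2]eq_sym.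
Qed.

Lemma doubled_matching_adj_irr (M : nat) : irreflexive (@doubled_matching_adj M).
Proof. by move=> u; rewrite /doubled_matching_adj !eqxx. Qed.

(** A vertex (s, i, b) is the end b of the i-th matching edge on side s. *)
Definition doubled_matching (M : nat) : sgraph :=
  SGraph (@doubled_matching_adj_sym M) (@doubled_matching_adj_irr M).

Lemma doubled_matching_bimatching (M : nat) :
  @bimatching (doubled_matching M) (fun u => u.1.1).
Proof.
move=> [[s i] b] [[s' i'] b'] [[s'' i''] b''] /=.
rewrite /doubled_matching_adj /= => h h' e e'; move: h h'; rewrite e e' eqxx /=.
by move=> /andP[/eqP<- +] /andP[/eqP<- +]; case: b; case: b'; case: b''.
Qed.

(** A missing edge xy joins two matching edges of one side. Adding it gives a wheel with hub x and
    rim y, q, p, q', where p is the partner of x and q, q' lie on the other side. *)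
Lemma doubled_matching_maximal (M : nat) :
  maximal_free wheel4 (doubled_matching M.+2).
Proof.
split; first exact: bimatching_wheel4_free (@doubled_matching_bimatching _).
move=> [[s i] b] [[s' i'] b'] nxy; rewrite /= {1}/doubled_matching_adj /=.
rewrite negb_or negbK => /andP[/eqP es]; rewrite -{}es in nxy *.
rewrite negb_and negbK => nib; have {nib nxy} nii : i != i'.
  apply: contra nxy => /eqP e; move: nib; rewrite e eqxx /= => /eqP->.
  by rewrite eqxx.
pose x : doubled_matching M.+2 := (s, i, b); pose y : doubled_matching M.+2 := (s, i', b').
pose p : doubled_matching M.+2 := (s, i, ~~ b).
pose q : doubled_matching M.+2 := (~~ s, ord0, true).
pose q' : doubled_matching M.+2 := (~~ s, ord0, false).
apply: (@edge_graph_copy _ _ (add_edge x y) x [:: x; y; q; p; q']) => //=.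
  rewrite !inE !xpair_eqE (negbTE nii) /= [i' == i]eq_sym (negbTE nii) !andbF /= !eqxx /=.
  by case: (s); case: (b); rewrite ?andbF.
rewrite /add_adj /= /doubled_matching_adj /= !xpair_eqE !eqxx.
rewrite (negbTE nii) [i' == i]eq_sym (negbTE nii) /=.
by case: (s); case: (b); case: (b'); rewrite ?andbF ?andbT ?orbT.
Qed.

(** A vertex is determined by being non-adjacent to itself and adjacent to its partner. *)
Lemma doubled_matching_twin_free (M : nat) : twin_free (doubled_matching M.+2).
Proof.
move=> [[s i] b] [[s' i'] b'] /setP e.
move: (e (s, i, b)) (e (s, i, ~~ b)).
rewrite !inE /= /doubled_matching_adj /= !eqxx /=.
have [->|ni] := eqVneq i' i.
  by case: s {e}; case: s'; case: b; case: b'; rewrite /= ?eqxx.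
by case: s {e}; case: s'; case: b; case: b'.
Qed.

Lemma card_doubled_matching (M : nat) : #|doubled_matching M| = 4 * M.
Proof. by rewrite !card_prod card_ord card_bool; lia. Qed.

Lemma doubled_matching_degree (M : nat) (v : doubled_matching M) : 2 * M <= #|nbh v|.
Proof.
pose g (u : 'I_M * bool) : doubled_matching M := (~~ v.1.1, u.1, u.2).
have ginj : injective g by move=> [i b] [i' b'] [-> ->].
apply: leq_trans (_ : #|[set g u | u in [set: 'I_M * bool]]| <= _).
  by rewrite card_imset // cardsT card_prod card_ord card_bool mulnC.
apply/subset_leq_card/subsetP => _ /imsetP[[i b] _ ->].
by rewrite !inE /= /doubled_matching_adj /=; case: (v.1.1).
Qed.

(** * From bounds on thresholds to families of graphs *)

Section ThresholdBounds.
Variables (R : realType) (H : sgraph).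
Local Open Scope ring_scope.

(** Puts 1 into the sets defining the thresholds. Lower bounds on the infima need these sets
    nonempty, since the infimum of the empty set is 0. *)
Lemma dense1_card0 (G : sgraph) : dense_graph (1 : R) G -> #|G| = 0%N.
Proof.
rewrite /dense_graph mul1r ler_nat => h; apply/eqP; rewrite -leqn0 leqNgt.
apply/negP => /card_gt0P[v _]; have := leq_trans h (min_degree_le v).
rewrite leqNgt => /negP; apply; rewrite -cardsT; apply: proper_card.
by rewrite properT; apply/negP => /eqP/setP/(_ v); rewrite !inE adj_irr.
Qed.

Lemma delta_chi_le (gamma : R) : 0 < gamma ->
  (exists C : nat, forall G : sgraph, H_free H G -> dense_graph gamma G ->
     (chromatic_number G <= C)%N) -> delta_chi R H <= gamma.
Proof. by move=> g0 h; apply: ge_inf; [exists 0 => x [/ltW]|split]. Qed.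

Lemma delta_VC_le (gamma : R) : 0 <= gamma ->
  (exists C : nat, forall G : sgraph, maximal_free H G -> dense_graph gamma G ->
     (vc_dim G <= C)%N) -> delta_VC R H <= gamma.
Proof. by move=> g0 h; apply: ge_inf; [exists 0 => x []|split]. Qed.

Lemma delta_B_le (gamma : R) : 0 <= gamma ->
  (exists F : sgraph, forall G : sgraph, maximal_free H G -> dense_graph gamma G ->
     is_blowup G F) -> delta_B R H <= gamma.
Proof. by move=> g0 h; apply: ge_inf; [exists 0 => x []|split]. Qed.

Lemma le_delta_VC (c : R) :
  (forall (gamma : R) (C : nat), 0 <= gamma -> gamma < c -> exists G : sgraph,
     [/\ maximal_free H G, dense_graph gamma G & (C < vc_dim G)%N]) ->
  c <= delta_VC R H.
Proof.
move=> h; apply: lb_le_inf.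
  exists 1; split=> //; exists 0%N => G _ /dense1_card0 G0.
  by have := vc_dim_le_card G; rewrite G0.
move=> gamma [g0 [C hC]]; rewrite leNgt; apply/negP => /(h _ C g0)[G [mG dG]].
by rewrite ltnNge hC.
Qed.

Lemma le_delta_B (c : R) :
  (forall (gamma : R) (F : sgraph), 0 <= gamma -> gamma < c -> exists G : sgraph,
     [/\ maximal_free H G, dense_graph gamma G & ~ is_blowup G F]) ->
  c <= delta_B R H.
Proof.
move=> h; apply: lb_le_inf.
  exists 1; split=> //; exists (universal_graph 0) => G _ /dense1_card0 G0.
  by apply: is_blowup_universal; rewrite G0.
move=> gamma [g0 [F hF]]; rewrite leNgt; apply/negP => /(h _ F g0)[G [mG dG]].
by apply; apply: hF.
Qed.

Lemma le_delta_hom (c : R) : (0 < #|H|)%N ->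
  (forall (gamma : R) (F : sgraph), 0 <= gamma -> gamma < c -> H_free H F ->
     exists G : sgraph, [/\ H_free H G, dense_graph gamma G & ~ homomorphic G F]) ->
  c <= delta_hom R H.
Proof.
move=> /card_gt0P[v0 _] h; apply: lb_le_inf.
  (* The target without vertices is free because [H] has a vertex. *)
  exists 1; split=> //; exists (edge_graph 0 [::]); split.
    by case=> f _ _; case: (f v0).
  move=> G _ /dense1_card0 G0.
  have noG (x : G) : False by move: (card0_eq G0 x).
  by exists (fun x => False_rect _ (noG x)) => x; case: (noG x).
move=> gamma [g0 [F [hF hom]]]; rewrite leNgt; apply/negP => lt.
by have [G [fG dG]] := h _ _ g0 lt hF; apply; apply: hom.
Qed.

End ThresholdBounds.

Lemma wheel4_dense_bimatching (R : realType) (G : sgraph) :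
  200 * 200 < #|G| -> dense_graph (49%:R / 100%:R : R)%R G -> H_free wheel4 G ->
  exists side : G -> bool, bimatching side.
Proof.
move=> hn dG; apply: wheel4_free_bimatching => // v.
apply: leq_trans (_ : 100 * min_degree G <= _); last by rewrite leq_mul2l min_degree_le orbT.
rewrite -(ler_nat R) !natrM; move: dG; rewrite /dense_graph.
by move: (#|G|%:R)%R ((min_degree G)%:R)%R => a b; lra.
Qed.

Lemma delta_chi_wheel4 (R : realType) : (delta_chi R wheel4 <= 49%:R / 100%:R)%R.
Proof.
apply: delta_chi_le; first by lra.
exists (200 * 200 + 4) => G fr dG; have [sm|/wheel4_dense_bimatching] := leqP #|G| (200 * 200).
  have := @chromatic_number_le G G id #|G| (leqnn _) (@adj_neq G).
  by move: sm; lia.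
move=> /(_ R dG fr)[side /bimatching_chromatic]; lia.
Qed.

Lemma delta_VC_wheel4 (R : realType) : (delta_VC R wheel4 <= 49%:R / 100%:R)%R.
Proof.
apply: delta_VC_le; first by lra.
exists (200 * 200 + 4) => G mx dG; have [sm|/wheel4_dense_bimatching] := leqP #|G| (200 * 200).
  by have := vc_dim_le_card G; move: sm; lia.
move=> /(_ R dG mx.1)[side /maximal_bimatching_vc_dim /(_ mx)]; lia.
Qed.

Lemma delta_B_wheel4 (R : realType) : (1 / 2%:R <= delta_B R wheel4)%R.
Proof.
apply: le_delta_B => gamma F g0 g1; exists (doubled_matching #|F|.+2); split.
- exact: doubled_matching_maximal.
- have h : 2 * #|F|.+2 <= min_degree (doubled_matching #|F|.+2).
    by apply: le_min_degree; [rewrite card_doubled_matching | exact: doubled_matching_degree].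
  rewrite /dense_graph card_doubled_matching.
  apply: le_trans (_ : _ <= (2 * #|F|.+2)%:R)%R _; last by rewrite ler_nat.
  rewrite !natrM; have : (0 <= #|F|.+2%:R :> R)%R by [].
  by move: (#|F|.+2%:R)%R => a; nra.
move/(blowup_twin_free_card (@doubled_matching_twin_free _)).
by rewrite card_doubled_matching; lia.
Qed.

(** * The 4-cycle with an isolated point *)

Definition cycle4_point : sgraph := edge_graph 5 [:: (0, 1); (1, 2); (2, 3); (3, 0)].

Definition cycle4_free (G : sgraph) : Prop :=
  forall x y a b : G, x != y -> adj x a -> adj x b -> adj y a -> adj y b -> a = b.

Lemma cycle4_free_cycle4_point_free (G : sgraph) :
  cycle4_free G -> H_free cycle4_point G.
Proof.
move=> c4 [f finj fh].
pose o0 := @Ordinal 5 0 isT; pose o1 := @Ordinal 5 1 isT.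
pose o2 := @Ordinal 5 2 isT; pose o3 := @Ordinal 5 3 isT.
have n02 : f o0 != f o2 by rewrite (inj_eq finj).
have := c4 _ _ _ _ n02 (fh o0 o1 isT) (fh o0 o3 isT) (fh o2 o1 isT) (fh o2 o3 isT).
by move/finj.
Qed.

Lemma exists_notin (T : finType) (s : seq T) : size s < #|T| -> exists x, x \notin s.
Proof.
move=> h; apply/existsP; rewrite -negb_forall; apply: contraL h => /forallP h.
rewrite -leqNgt; apply: leq_trans (card_size s).
by apply/subset_leq_card/subsetP => x _; apply: h.
Qed.

(** With more than four vertices, any 4-cycle leaves a vertex over for the isolated point. *)
Lemma cycle4_point_free_cycle4_free (G : sgraph) :
  4 < #|G| -> H_free cycle4_point G -> cycle4_free G.
Proof.
move=> hn fr x y a b nxy xa xb ya yb; apply/eqP/negPn/negP => nab.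
have [z] := @exists_notin G [:: x; a; y; b] hn.
rewrite !inE !negb_or => /and4P[zx za zy zb]; apply: fr.
apply: (@edge_graph_copy _ _ _ x [:: x; a; y; b; z]) => //=.
  rewrite !inE !negb_or (adj_neq xa) (adj_neq xb) (adj_neq yb) nxy nab.
  by rewrite ![_ == z]eq_sym zx za zy zb [a == y]eq_sym (adj_neq ya).
by rewrite xa yb [adj a y]adj_sym ya [adj b x]adj_sym xb.
Qed.

(** Neighbourhoods pairwise share at most one vertex. Packing k of them with k * gamma >= 2 gives 2n
    <= n + k^2. *)
Lemma cycle4_point_free_dense_card (R : realType) (gamma : R) : (0 < gamma)%R ->
  exists N : nat, forall G : sgraph,
    H_free cycle4_point G -> dense_graph gamma G -> #|G| <= N.
Proof.
move=> g0; pose k := Num.bound (2%:R / gamma)%R.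
have hk : (2%:R <= gamma * k%:R)%R.
  have := @archi_boundP R (2%:R / gamma)%R; rewrite -/k => h.
  rewrite mulrC -ler_pdivrMr //; apply/ltW/h.
  by apply: divr_ge0 => //; apply: ltW.
(* The summands serve the packing bound, the choice of k vertices and the fifth vertex. *)
exists (k ^ 2 + k + 4) => G fr dG; rewrite leqNgt; apply/negP => hn.
have c4 : cycle4_free G by apply: cycle4_point_free_cycle4_free fr; lia.
have [D _ cD] : exists2 D : {set G}, D \subset [set: G] & #|D| = k.
  by apply: subset_of_card; rewrite cardsT; lia.
have : k * min_degree G <= #|G| + k ^ 2.
  rewrite -cD -[#|D| ^ 2]mul1n; apply: (@card_almost_disjoint _ _ _ (@nbh G)) => [x _|].
    exact: min_degree_le.
  move=> x y _ _ nxy; apply/card_le1_eqP => a b.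
  rewrite !inE => /andP[xa ya] /andP[xb yb].
  exact: c4 nxy xb xa yb ya.
apply/negP; rewrite -ltnNge -(ltr_nat R) natrD natrM.
have : ((k ^ 2)%:R < #|G|%:R :> R)%R by rewrite ltr_nat; lia.
move: dG hk; rewrite /dense_graph.
move: (ler0n R k) (ler0n R #|G|).
move: (#|G|%:R)%R ((min_degree G)%:R)%R ((k ^ 2)%:R)%R (k%:R)%R => a b c K K0 a0 ab gK ca.
have := ler_wpM2l K0 ab; have := ler_wpM2r a0 gK; lra.
Qed.

Lemma delta_small_cycle4_point (R : realType) (gamma : R) : (0 < gamma)%R ->
  [/\ delta_chi R cycle4_point <= gamma, delta_VC R cycle4_point <= gamma
    & delta_B R cycle4_point <= gamma]%R.
Proof.
move=> g0; have [N hN] := cycle4_point_free_dense_card g0; split.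
- apply: delta_chi_le => //; exists N => G fr dG.
  by apply: (@chromatic_number_le G G id) (@adj_neq G); apply: hN.
- apply: delta_VC_le; first exact: ltW.
  by exists N => G [fr _] dG; apply: leq_trans (vc_dim_le_card _) (hN _ fr dG).
apply: delta_B_le; first exact: ltW.
by exists (universal_graph N) => G [fr _] dG; apply/is_blowup_universal/hN.
Qed.

(** * C4-free graphs of large chromatic number *)

Section Descartes.
Variables (G : sgraph) (m : nat).

Definition descartes_adj : rel ('I_m + {ffun G -> 'I_m} * G) := fun a b =>
  match a, b with
  | inl _, inl _ => false
  | inl s, inr (phi, v) | inr (phi, v), inl s => injectiveb phi && (phi v == s)
  | inr (phi, v), inr (psi, w) => (phi == psi) && adj v w
  end.

Lemma descartes_adj_sym : symmetric descartes_adj.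
Proof. by move=> [s|[phi v]] [t|[psi w]] //=; rewrite eq_sym adj_sym. Qed.

Lemma descartes_adj_irr : irreflexive descartes_adj.
Proof. by move=> [s|[phi v]] //=; rewrite adj_irr andbF. Qed.

(* Blanche Descartes' construction: one copy of G is matched to each injective
   placement of its vertices in an independent set of size m; the copies
   indexed by non-injective maps are left unattached. *)
Definition descartes : sgraph := SGraph descartes_adj_sym descartes_adj_irr.

(** A vertex of a copy has at most one neighbour in the independent set, and by injectivity a point
    of that set has at most one neighbour in each copy. So a 4-cycle would lie inside one copy. *)
Lemma descartes_cycle4_free : cycle4_free G -> cycle4_free descartes.
Proof.
move=> c4 [s|[phi v]] [t|[psi w]] [a|[al a]] [b|[be b]] //= n.
- by move=> /andP[_ /eqP e1] _ /andP[_ /eqP e2] _; rewrite -e1 -e2 eqxx in n.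
- move=> /andP[/injectiveP inj /eqP<-] /andP[_ /eqP e] /andP[/eqP eq1 _] /andP[/eqP eq2 _].
  by move: e; rewrite -eq1 -eq2 in inj * => /inj->.
- move=> /andP[/eqP eq1 _] /andP[/eqP eq2 _] /andP[/injectiveP inj /eqP<-] /andP[_ /eqP e].
  by move: e; rewrite -eq1 -eq2 in inj * => /inj->.
- by move=> /andP[_ /eqP->] /andP[_ /eqP->].
- move=> /andP[/injectiveP inj /eqP<-] /andP[/eqP<- _] /andP[_ /eqP e] /andP[/eqP eq1 _].
  by move: e n; rewrite eq1 => /inj->; rewrite eqxx.
- move=> /andP[/eqP<- _] /andP[/injectiveP inj /eqP<-] /andP[/eqP eq1 _] /andP[_ /eqP e].
  by move: e n; rewrite eq1 => /inj->; rewrite eqxx.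
move=> /andP[/eqP e1 va] /andP[/eqP e2 vb] /andP[/eqP e3 wa] /andP[_ wb].
rewrite -e1 -e2; rewrite e3 -e1 in n; congr (inr (_, _)).
by apply: c4 va vb wa wb; apply: contra n => /eqP->.
Qed.

Lemma descartes_no_isolated : #|G| <= m ->
  (forall v : G, exists w, adj v w) -> 0 < #|G| ->
  forall v : descartes, exists w, adj v w.
Proof.
move=> hm iso /card_gt0P[v0 _] [s|[phi v]]; last first.
  by have [w vw] := iso v; exists (inr (phi, w)); rewrite /= eqxx.
pose i v := widen_ord hm (enum_rank v).
have iinj : injective i by move=> x y /(congr1 val) /= /val_inj /enum_rank_inj.
(* The transposition redirects a fixed placement so that [v0] is matched to [s]. *)
exists (inr ([ffun v => tperm (i v0) s (i v)], v0)); rewrite /= ffunE tpermL eqxx andbT.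
by apply/injectiveP => x y; rewrite !ffunE => /perm_inj /iinj.
Qed.

(** By pigeonhole some colour i occurs on #|G| points of the independent set. The copy placed on
    them avoids i, so [G] would be k-colourable. *)
Lemma descartes_not_colorable (k : nat) : #|G| * k.+1 <= m -> 0 < #|G| ->
  ~ (exists c : G -> 'I_k, forall x y, adj x y -> c x != c y) ->
  ~ (exists c : descartes -> 'I_k.+1, forall x y, adj x y -> c x != c y).
Proof.
move=> hm G0 nc [c hc]; apply: nc.
pose A i := [set s | c (inl s) == i].
have [i hi] : exists i, #|G| <= #|A i|.
  apply/existsP; rewrite -[X in is_true X]negbK negb_exists; apply/negP => /forallP h.
  have : m <= \sum_(i < k.+1) #|A i|.
    rewrite -[X in X <= _]card_ord -sum1_card (partition_big (fun s => c (inl s)) predT) //=.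
    by apply: leq_sum => i _; rewrite sum1dep_card.
  have : \sum_(i < k.+1) #|A i| <= \sum_(i < k.+1) #|G|.-1.
    by apply: leq_sum => i _; have := h i; lia.
  rewrite sum_nat_const card_ord; nia.
pose phi := [ffun v : G => enum_val (widen_ord hi (enum_rank v))].
have phi_inj : injectiveb phi.
  apply/injectiveP => x y; rewrite !ffunE => /enum_val_inj /(congr1 val) /=.
  by move/val_inj/enum_rank_inj.
have ci v : i != c (inr (phi, v)).
  have : phi v \in A i by rewrite ffunE; apply: enum_valP.
  rewrite inE => /eqP <-; apply: hc.
  by rewrite /= phi_inj eqxx.
exists (fun v => s2val (unlift_some (ci v))) => x y xy.
have : c (inr (phi, x)) != c (inr (phi, y)) by apply: hc; rewrite /= eqxx.
apply: contra => /eqP e; apply/eqP; apply: etrans (s2valP (unlift_some (ci x))) _.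
exact: etrans (congr1 (lift i) e) (esym (s2valP (unlift_some (ci y)))).
Qed.

End Descartes.

(** The induction starts from a single edge. The absence of isolated vertices is carried along to
    give minimum degree at least 1, hence a positive density. *)
Lemma cycle4_free_not_colorable (k : nat) : exists G : sgraph,
  [/\ cycle4_free G, 1 < #|G|, forall v : G, exists w, adj v w &
      ~ (exists c : G -> 'I_k.+1, forall x y, adj x y -> c x != c y)].
Proof.
elim: k => [|k [G [c4 G0 iso nc]]].
  exists (edge_graph 2 [:: (0, 1)]); split.
  - move=> x y a b n xa xb ya yb; move: n xa xb ya yb.
    case: x y a b => -[|[|//]] ? [] [|[|//]] ? [] [|[|//]] ? [] [|[|//]] ? //=.
  - by rewrite card_ord.
  - case=> -[|[|//]] h; first by exists (@Ordinal 2 1 isT).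
    by exists (@Ordinal 2 0 isT).
  case=> c /(_ (@Ordinal 2 0 isT) (@Ordinal 2 1 isT) isT).
  by rewrite !ord1.
exists (descartes G (#|G| * k.+2)); split.
- exact: descartes_cycle4_free.
- by rewrite card_sum card_ord; nia.
- by apply: descartes_no_isolated => //; nia.
by apply: descartes_not_colorable => //; lia.
Qed.

Lemma delta_hom_cycle4_point (R : realType) :
  exists2 c : R, (0 < c)%R & (c <= delta_hom R cycle4_point)%R.
Proof.
have [G [c4 G0 iso nc]] := cycle4_free_not_colorable 3.
have Gpos : (0 < #|G|%:R :> R)%R by rewrite ltr0n; lia.
exists (#|G|%:R^-1)%R; first by rewrite invr_gt0.
apply: le_delta_hom; first by rewrite card_ord.
move=> gamma F g0 g1 fF; pose K4 := edge_graph 4 [:: (0,1); (0,2); (0,3); (1,2); (1,3); (2,3)].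
have g2 : (gamma * #|G|%:R <= 1)%R by rewrite -ler_pdivlMr // div1r ltW.
have fK : H_free cycle4_point K4.
  by case=> f /leq_card; rewrite !card_ord.
have K4adj (x y : K4) : x != y -> adj x y.
  by case: x y => -[|[|[|[|//]]]] ? [] [|[|[|[|//]]]] ?.
have dK : dense_graph gamma K4.
  have h : 3 <= min_degree K4.
    apply: le_min_degree; first by rewrite card_ord.
    move=> v; apply: (@leq_trans #|[set~ v]|); first by rewrite cardsC1 card_ord.
    apply/subset_leq_card/subsetP => w.
    by rewrite !inE eq_sym => /K4adj.
  rewrite /dense_graph; apply: le_trans (_ : 3%:R <= _)%R; last by rewrite ler_nat.
  rewrite card_ord; have : (2%:R <= #|G|%:R :> R)%R by rewrite ler_nat.
  by move: (#|G|%:R)%R g2 => a; nra.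
(* If K4 maps to [F], then [F] contains a 4-cycle and, being free, has at most four vertices; a
   homomorphism from [G] would be a 4-colouring. *)
case: (pselect (homomorphic K4 F)) => [[f fh]|nh]; last by exists K4.
have finj : injective f.
  by move=> x y e; apply/eqP/negPn/negP => /K4adj /fh; rewrite e adj_irr.
exists G; split.
- exact: cycle4_free_cycle4_point_free.
- rewrite /dense_graph; apply: le_trans g2 _; rewrite ler1n.
  apply: le_min_degree => [|v]; first by lia.
  by have [w vw] := iso v; apply/card_gt0P; exists w; rewrite inE.
case=> g gh; have [big|small] := ltnP 4 #|F|.
  have c4F := cycle4_point_free_cycle4_free big fF.
  pose o0 : K4 := @Ordinal 4 0 isT; pose o1 : K4 := @Ordinal 4 1 isT.
  pose o2 : K4 := @Ordinal 4 2 isT; pose o3 : K4 := @Ordinal 4 3 isT.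
  have n01 : f o0 != f o1 by rewrite (inj_eq finj).
  have := c4F _ _ _ _ n01 (fh o0 o2 isT) (fh o0 o3 isT) (fh o1 o2 isT) (fh o1 o3 isT).
  by move/finj.
apply: nc; exists (fun x => widen_ord small (enum_rank (g x))) => x y /gh/adj_neq.
by apply: contra => /eqP/(congr1 val) /= /val_inj /enum_rank_inj ->.
Qed.

Lemma delta_cycle4_point (R : realType) :
  [/\ delta_chi R cycle4_point < delta_hom R cycle4_point,
      delta_VC R cycle4_point < delta_hom R cycle4_point
    & delta_B R cycle4_point < delta_hom R cycle4_point]%R.
Proof.
have [c c0 hc] := delta_hom_cycle4_point R.
have [|h1 h2 h3] := @delta_small_cycle4_point R (c / 2%:R)%R; first by lra.
by split; lra.
Qed.

(** * The 5-cycle: bounded chromatic number *)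

Definition cycle5 : sgraph := edge_graph 5 [:: (0, 1); (1, 2); (2, 3); (3, 4); (4, 0)].

Lemma cycle5_copy (G : sgraph) (a b c d e : G) :
  uniq [:: a; b; c; d; e] -> adj a b -> adj b c -> adj c d -> adj d e -> adj e a ->
  contains_copy cycle5 G.
Proof.
move=> u ab bc cd de ea; apply: (@edge_graph_copy _ _ _ a [:: a; b; c; d; e]) => //=.
by rewrite ab bc cd de ea.
Qed.

Definition rises1 (G : sgraph) (a x : G) : bool :=
  [exists y, [&& y \in nbh a, adj y x & enum_rank y < enum_rank x]].

Definition rises2 (G : sgraph) (a x : G) : bool :=
  [exists y, [&& y \in nbh a, adj y x, enum_rank y < enum_rank x & rises1 a y]].

(* Neighbourhoods contain no path on four vertices; as in the Gallai-Roy
   theorem, the length of a longest increasing path ending at x is a proper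
   colouring. *)
Lemma cycle5_free_nbh_coloring (G : sgraph) (a x y : G) : H_free cycle5 G ->
  x \in nbh a -> y \in nbh a -> adj x y ->
  (rises1 a x, rises2 a x) != (rises1 a y, rises2 a y).
Proof.
move=> fr; wlog lt : x y / enum_rank x < enum_rank y.
  move=> W xa ya xy; have : enum_rank x != enum_rank y.
    by rewrite (inj_eq enum_rank_inj) adj_neq.
  rewrite neq_ltn => /orP[] lt; first exact: W.
  by rewrite eq_sym; apply: W => //; rewrite adj_sym.
move=> xa ya xy; apply/eqP => -[e1 e2].
have r1 : rises1 a y by apply/existsP; exists x; rewrite xa xy.
have : rises2 a y by apply/existsP; exists x; rewrite xa xy lt e1.
(* The increasing path t z x y inside N(a) closes to a 5-cycle through [a]. *)
rewrite -e2 => /existsP[z /and4P[za zx ltzx /existsP[t /and3P[ta tz lttz]]]].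
apply: fr; apply: (@cycle5_copy _ a t z x y) => //; last first.
- by rewrite adj_sym; rewrite inE in ya.
- by rewrite inE in ta.
rewrite !inE in xa ya za ta; rewrite /= !inE !negb_or.
rewrite !(adj_neq xa) !(adj_neq ya) !(adj_neq za) !(adj_neq ta).
rewrite (adj_neq tz) (adj_neq zx) (adj_neq xy) /=.
rewrite -![t == _](inj_eq enum_rank_inj) -![z == _](inj_eq enum_rank_inj).
by rewrite !neq_ltn (ltn_trans lttz ltzx) (ltn_trans (ltn_trans lttz ltzx) lt) (ltn_trans ltzx lt).
Qed.

(** Every u shares a neighbour a(u) with some v(u) in a maximal family [D] of vertices with disjoint
    neighbourhoods, and [D] has at most k members. Adjacent x, y of one colour have the same v. They
    cannot both lie in N(v), by the colouring of N(v); otherwise either a(x) = a(y), excluded by the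
    colouring of N(a(x)), or v a(x) x y a(y) is a 5-cycle. *)
Lemma cycle5_free_chromatic (G : sgraph) (k : nat) :
  H_free cycle5 G -> #|G| <= k * min_degree G -> chromatic_number G <= 64 * k.
Proof.
move=> fr hk; have [G0|Gpos] := posnP #|G|.
  have := @chromatic_number_le G G id #|G| (leqnn _) (@adj_neq G).
  by rewrite G0; lia.
have dpos : 0 < min_degree G by nia.
pose indep (D : {set G}) := [forall x in D, forall y in D, (x != y) ==> [disjoint nbh x & nbh y]].
have ind0 : indep set0 by apply/forall_inP => x; rewrite inE.
have [D /maxsetP[indD maxD]] : {D | maxset indep D}.
  by have [D mD _] := maxset_exists ind0; exists D.
have cD : #|D| <= k.
  have := @card_almost_disjoint G G D (@nbh G) 0 (min_degree G).
  move=> h; have {h} : #|D| * min_degree G <= #|G| + 0 * #|D| ^ 2; last by nia.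
  apply: h => [x _|x y xD yD nxy]; first exact: min_degree_le.
  move/forall_inP: indD => /(_ x xD)/forall_inP/(_ y yD)/implyP/(_ nxy).
  by rewrite -setI_eq0 => /eqP->; rewrite cards0.
have center u : exists v a : G, [/\ v \in D, adj v a & adj u a].
  have deg (x : G) : exists a, adj x a.
    have : 0 < #|nbh x| by exact: leq_trans dpos (min_degree_le x).
    by case/card_gt0P => a; rewrite inE; exists a.
  have [uD|uD] := boolP (u \in D); first by have [a ua] := deg u; exists u, a.
  apply: contrapT => no; case/negP: uD; rewrite -(maxD (u |: D)) ?subsetUr ?setU11 //.
  have dis v : v \in D -> [disjoint nbh u & nbh v].
    move=> vD; rewrite -setI_eq0; apply/eqP/setP => a; rewrite !inE.
    by apply/negP => /andP[ua va]; apply: no; exists v, a.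
  apply/forall_inP => x xD; apply/forall_inP => y yD; apply/implyP => nxy.
  move: xD yD nxy; rewrite !inE => /orP[/eqP->|xD] /orP[/eqP->|yD]; rewrite ?eqxx //.
  - by move=> _; apply: dis.
  - by move=> _; rewrite disjoint_sym; apply: dis.
  by move/forall_inP: indD => /(_ x xD)/forall_inP/(_ y yD)/implyP.
have [v /(_ _)/cid hv] := choice center.
pose a u := sval (hv u).
have va u : [/\ v u \in D, adj (v u) (a u) & adj u (a u)] := svalP (hv u).
have iD u : index (v u) (enum D) < k.
  apply: leq_trans cD; rewrite cardE index_mem mem_enum.
  by have [] := va u.
(* Two flags and two colourings of neighbourhoods with four colours each: 2 * 2 * 4 * 4 = 64. *)
pose col u := (Ordinal (iD u), (u == v u, adj u (v u)),
  ((rises1 (v u) u, rises2 (v u) u), (rises1 (a u) u, rises2 (a u) u))).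
apply: (chromatic_number_le (c := col)); first by rewrite !card_prod card_ord card_bool; lia.
move=> x y xy; apply/eqP => -[ei e1 e2 c1 c2 c3 c4].
have [vxD vax xax] := va x; have [vyD vay yay] := va y.
have ev : v x = v y.
  by rewrite -(nth_index x (s := enum D) (x := v x)) ?mem_enum // ei nth_index ?mem_enum.
rewrite -ev in e1 e2 c1 c2 vay.
have nx : x != v x.
  by apply/negP => h; move: (h); rewrite e1 => /eqP ey; move: xy; rewrite ey -(eqP h) adj_irr.
have ny : y != v x by rewrite -e1.
have [inx|outx] := boolP (adj x (v x)).
  have : (rises1 (v x) x, rises2 (v x) x) != (rises1 (v x) y, rises2 (v x) y).
    apply: cycle5_free_nbh_coloring fr _ _ xy; rewrite inE adj_sym //.
    by rewrite -e2.
  by rewrite c1 c2 eqxx.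
have outy : ~~ adj y (v x) by rewrite -e2.
have ea : a x = a y.
  apply/eqP/negPn/negP => na; apply: fr.
  apply: (@cycle5_copy _ (v x) (a x) x y (a y)) => //; rewrite 1?[adj (a _) _]adj_sym //.
  rewrite /= !inE !negb_or (adj_neq vax) (adj_neq vay) ![v x == _]eq_sym nx ny.
  rewrite [a x == x]eq_sym (adj_neq xax) na (adj_neq xy) (adj_neq yay) /= !andbT.
  apply/andP; split.
    by apply: contra outy => /eqP <-; rewrite adj_sym.
  by apply: contra outx => /eqP e; rewrite {1}e adj_sym.
have : (rises1 (a x) x, rises2 (a x) x) != (rises1 (a x) y, rises2 (a x) y).
  by apply: cycle5_free_nbh_coloring fr _ _ xy; rewrite inE adj_sym // ea.
by rewrite c3 c4 ea eqxx.
Qed.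

(** The value 1/16 is chosen below the lower bound 1/15 for the VC-dimension threshold. *)
Lemma delta_chi_cycle5 (R : realType) : (delta_chi R cycle5 <= 1 / 16%:R)%R.
Proof.
apply: delta_chi_le; first by lra.
exists (64 * 16) => G fr dG; apply: cycle5_free_chromatic fr _.
rewrite -(ler_nat R) natrM; move: dG; rewrite /dense_graph.
by move: (#|G|%:R)%R ((min_degree G)%:R)%R => a b; lra.
Qed.

(** * The 5-cycle: a frozen shattered set *)

Section ShatteringGraph.
Variable m : nat.
Let P : finType := ('I_m.+1 * {set 'I_m.+1})%type.

(* Layers 0 and 1 carry the points s and the sets t, joined when s is in t; for
   s not in t the layers 2, 3, 4 contain a private path closing a 5-cycle with
   the missing edge st.  Layers q + 5 and q + 10 only raise the degrees. *)
Definition shatter_half (u v : 'I_15 * P) : bool :=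
  match val u.1, val v.1 with
  | 0, 1 => u.2.1 \in v.2.2
  | 1, 2 => u.2.2 == v.2.2
  | 2, 3 => (u.2 == v.2) && (u.2.1 \notin u.2.2)
  | 3, 4 => u.2 == v.2
  | 4, 0 => u.2.1 == v.2.1
  | q, q' => (q < 10) && (q' == q + 5)
  end.

Definition shatter_adj : rel ('I_15 * P) :=
  fun u v => shatter_half u v || shatter_half v u.

Lemma shatter_adj_sym : symmetric shatter_adj.
Proof. by move=> u v; rewrite /shatter_adj orbC. Qed.

Lemma shatter_adj_irr : irreflexive shatter_adj.
Proof.
move=> [[q hq] p]; rewrite /shatter_adj orbb /shatter_half /=.
by do 15? [case: q hq => [|q] hq //].
Qed.

Definition shatter_graph : sgraph := SGraph shatter_adj_sym shatter_adj_irr.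

(** The graph of layers: a 5-cycle with a pendant path of length two at each vertex. *)
Definition layer_edge (q r : nat) : bool :=
  ((q, r) \in [:: (0, 1); (1, 2); (2, 3); (3, 4); (4, 0)]) || (q < 10) && (r == q + 5).

Definition layer_adj (q r : nat) : bool := layer_edge q r || layer_edge r q.

Lemma shatter_layer_adj (u v : shatter_graph) : adj u v -> layer_adj (val u.1) (val v.1).
Proof.
have half (x y : 'I_15 * P) : shatter_half x y -> layer_edge (val x.1) (val y.1).
  case: x y => [[q hq] p] [[r hr] p']; rewrite /shatter_half /=.
  by case: q hq => [|[|[|[|[|q]]]]] hq; case: r hr => [|[|[|[|[|r]]]]] hr //= ->;
    rewrite /layer_edge ?orbT.
by case/orP => /half; rewrite /layer_adj => ->; rewrite ?orbT.
Qed.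

Definition layer_cycles : seq (seq nat) :=
  [seq rot i [:: 0; 1; 2; 3; 4] | i <- iota 0 5] ++
  [seq rot i [:: 4; 3; 2; 1; 0] | i <- iota 0 5].

(** An odd closed walk must traverse the only odd cycle, which already has length five; the finite
    check is by computation. *)
Lemma closed_layer_walk (a b c d e : nat) :
  a < 15 -> b < 15 -> c < 15 -> d < 15 -> e < 15 ->
  layer_adj a b -> layer_adj b c -> layer_adj c d -> layer_adj d e -> layer_adj e a ->
  [:: a; b; c; d; e] \in layer_cycles.
Proof.
have check : all (fun a => all (fun b => if layer_adj a b then
    all (fun c => if layer_adj b c then
    all (fun d => if layer_adj c d then
    all (fun e => if layer_adj d e then
       if layer_adj e a then [:: a; b; c; d; e] \in layer_cycles else true else true)
    (iota 0 15) else true) (iota 0 15) else true) (iota 0 15) else true)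
    (iota 0 15)) (iota 0 15) by vm_compute.
move=> ha hb hc hd he ab bc cd de ea.
have mem x : x < 15 -> x \in iota 0 15 by rewrite mem_iota.
move/allP: check => /(_ a (mem a ha))/allP/(_ b (mem b hb)); rewrite ab.
move/allP => /(_ c (mem c hc)); rewrite bc => /allP/(_ d (mem d hd)); rewrite cd.
by move/allP => /(_ e (mem e he)); rewrite de ea.
Qed.

(** A 5-cycle would run once around layers 0 to 4. Its edges force a single pair (s, t), with s in t
    between layers 0 and 1 and s not in t between layers 2 and 3. *)
Lemma shatter_graph_cycle5_free : H_free cycle5 shatter_graph.
Proof.
case=> f _ fh.
pose a := f (@Ordinal 5 0 isT); pose b := f (@Ordinal 5 1 isT).
pose c := f (@Ordinal 5 2 isT); pose d := f (@Ordinal 5 3 isT).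
pose e := f (@Ordinal 5 4 isT).
have ab : adj a b by apply: fh.
have bc : adj b c by apply: fh.
have cd : adj c d by apply: fh.
have de : adj d e by apply: fh.
have ea : adj e a by apply: fh.
have core (s t x y z : shatter_graph) : adj s t -> adj t x -> adj x y -> adj y z -> adj z s ->
    [:: val s.1; val t.1; val x.1; val y.1; val z.1] = [:: 0; 1; 2; 3; 4] -> False.
  case: s t x y z => [s [s1 s2]] [t [t1 t2]] [x [x1 x2]] [y [y1 y2]] [z [z1 z2]].
  rewrite /= /shatter_adj /shatter_half /= => + + + + + [es et ex ey ez].
  rewrite es et ex ey ez /= !orbF => st /eqP tx /andP[/eqP[xy1 xy2] nx] /eqP[yz1 yz2] /eqP zs.
  by move: nx; rewrite -tx xy1 yz1 zs st.
have := closed_layer_walk (ltn_ord a.1) (ltn_ord b.1) (ltn_ord c.1) (ltn_ord d.1)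
  (ltn_ord e.1) (shatter_layer_adj ab) (shatter_layer_adj bc) (shatter_layer_adj cd)
  (shatter_layer_adj de) (shatter_layer_adj ea).
have ba : adj b a by rewrite adj_sym.
have cb : adj c b by rewrite adj_sym.
have dc : adj d c by rewrite adj_sym.
have ed : adj e d by rewrite adj_sym.
have ae : adj a e by rewrite adj_sym.
rewrite /layer_cycles /= /rot /= !inE.
repeat (case/orP); move/eqP => -[ea' eb ec ed' ee];
  first [ by apply: (core a b c d e) => //=; rewrite ea' eb ec ed' ee
        | by apply: (core b c d e a) => //=; rewrite ea' eb ec ed' ee
        | by apply: (core c d e a b) => //=; rewrite ea' eb ec ed' ee
        | by apply: (core d e a b c) => //=; rewrite ea' eb ec ed' ee
        | by apply: (core e a b c d) => //=; rewrite ea' eb ec ed' ee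
        | by apply: (core e d c b a) => //=; rewrite ea' eb ec ed' ee
        | by apply: (core d c b a e) => //=; rewrite ea' eb ec ed' ee
        | by apply: (core c b a e d) => //=; rewrite ea' eb ec ed' ee
        | by apply: (core b a e d c) => //=; rewrite ea' eb ec ed' ee
        | by apply: (core a e d c b) => //=; rewrite ea' eb ec ed' ee ].
Qed.

(** Each layer is completely joined to the one five above or five below, which yields density
    1/15. *)
Lemma shatter_graph_degree (v : shatter_graph) : #|P| <= #|nbh v|.
Proof.
case: v => [[q hq] p].
have hq' : (if q < 10 then q + 5 else q - 5) < 15 by case: ifP; lia.
pose g (p' : P) : shatter_graph := (Ordinal hq', p').
have ginj : injective g by move=> x y [].
rewrite -cardsT -(card_imset _ ginj); apply/subset_leq_card/subsetP => _ /imsetP[p' _ ->].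
rewrite inE /= /shatter_adj /shatter_half /= {g ginj hq'}.
by do 15? [case: q hq => [|q] hq //].
Qed.

Lemma card_shatter_graph : #|shatter_graph| = 15 * #|P|.
Proof. by rewrite card_prod card_ord. Qed.

(** Incidences survive as edges. A non-incident pair cannot become adjacent in [G], since its
    private path would close to a 5-cycle; so the m + 1 points stay shattered. *)
Lemma shatter_graph_vc_dim (G : sgraph) (f : shatter_graph -> G) :
  injective f -> is_hom f -> H_free cycle5 G -> m < vc_dim G.
Proof.
move=> finj fh fr.
(* Points and sets are represented with the dummy coordinates [set0] and [ord0]. *)
pose o q (h : q < 15) (s : 'I_m.+1) t : shatter_graph := (Ordinal h, (s, t)).
pose pt s := f (o 0 isT s set0); pose st t := f (o 1 isT ord0 t).
have pt_inj : injective pt by move=> s s' /finj [].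
have stE s t : adj (st t) (pt s) = (s \in t).
  apply/idP/idP => [h|sIt]; last by apply: fh; rewrite /= /shatter_adj /shatter_half /= sIt.
  apply: contraT => nst; case: fr.
  apply: (@cycle5_copy _ (st t) (pt s) (f (o 4 isT s t)) (f (o 3 isT s t)) (f (o 2 isT s t))) => //.
  - by rewrite (map_inj_uniq finj [:: o 1 isT ord0 t; o 0 isT s set0; o 4 isT s t;
       o 3 isT s t; o 2 isT s t]).
  - by apply: fh; rewrite /= /shatter_adj /shatter_half /= eqxx.
  - by apply: fh; rewrite /= /shatter_adj /shatter_half /= eqxx.
  - by apply: fh; rewrite /= /shatter_adj /shatter_half /= eqxx nst.
  by apply: fh; rewrite /= /shatter_adj /shatter_half /= eqxx.
pose S := [set pt s | s : 'I_m.+1].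
have cS : #|S| = m.+1 by rewrite card_imset // card_ord.
rewrite -cS; rewrite /vc_dim; apply: (@leq_bigmax_cond _ (@shattered G) (fun A : {set G} => #|A|)).
apply/eqP/setP => U; rewrite inE; apply/imsetP/idP => [[v _ ->]|/subsetP US].
  exact: subsetIr.
exists (st [set s | pt s \in U]) => //; apply/setP => x; rewrite !inE.
apply/idP/andP => [xU|[+ /imsetP[s _ ex]]]; last by rewrite ex stE inE.
split; last exact: US.
by have /imsetP[s _ ex] := US _ xU; rewrite ex stE inE -ex.
Qed.

End ShatteringGraph.

Lemma delta_VC_cycle5 (R : realType) : (1 / 15%:R <= delta_VC R cycle5)%R.
Proof.
apply: le_delta_VC => gamma C g0 g1.
have [G [f [fb fh fm]]] := maximal_free_extension (@shatter_graph_cycle5_free C).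
exists G; split => //; last exact: shatter_graph_vc_dim (bij_inj fb) fh fm.1.
set p := #|(('I_C.+1 * {set 'I_C.+1})%type : finType)|.
have p0 : 0 < p by apply/card_gt0P; exists (ord0, set0).
have h : p <= min_degree G.
  apply: leq_trans (hom_min_degree fb fh); apply: le_min_degree; last first.
    exact: shatter_graph_degree.
  by rewrite card_shatter_graph muln_gt0.
rewrite /dense_graph -(bij_eq_card fb) card_shatter_graph -/p.
apply: le_trans (_ : _ <= p%:R)%R _; last by rewrite ler_nat.
rewrite natrM; have : (0 <= p%:R :> R)%R by [].
by move: (p%:R)%R => a; nra.
Qed.

(** * Separation of the four thresholds *)

Theorem corollary1p6 (R : realType) (p q : parameter) :
  p <> q -> exists H : sgraph, delta R p H <> delta R q H.
Proof.
have [chi_hom VC_hom B_hom] := delta_cycle4_point R.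
have chi_VC : (delta_chi R cycle5 < delta_VC R cycle5)%R.
  by have := delta_chi_cycle5 R; have := delta_VC_cycle5 R; lra.
have chi_B : (delta_chi R wheel4 < delta_B R wheel4)%R.
  by have := delta_chi_wheel4 R; have := delta_B_wheel4 R; lra.
have VC_B : (delta_VC R wheel4 < delta_B R wheel4)%R.
  by have := delta_VC_wheel4 R; have := delta_B_wheel4 R; lra.
have neq (a b : R) : (a < b)%R -> a <> b /\ b <> a.
  by move=> ab; split=> e; rewrite e ltxx in ab.
case: p; case: q => // _.
- by exists cycle4_point; have [] := neq _ _ chi_hom.
- by exists cycle5; have [] := neq _ _ chi_VC.
- by exists wheel4; have [] := neq _ _ chi_B.
- by exists cycle4_point; have [] := neq _ _ chi_hom.
- by exists cycle4_point; have [] := neq _ _ VC_hom.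
- by exists cycle4_point; have [] := neq _ _ B_hom.
- by exists cycle5; have [] := neq _ _ chi_VC.
- by exists cycle4_point; have [] := neq _ _ VC_hom.
- by exists wheel4; have [] := neq _ _ VC_B.
- by exists wheel4; have [] := neq _ _ chi_B.
- by exists cycle4_point; have [] := neq _ _ B_hom.
- by exists wheel4; have [] := neq _ _ VC_B.
Qed.
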